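(* Consider the load-balancing averaging algorithm (described in the context) on time-varying sequences of symmetric graphs with bounded interconnectivity times with parameter $B$, with worst-case convergence time $T_n(B,\epsilon)$. There exists a constant $c>0$ such that for every $n$, every $B$, and every $1>\epsilon>0$, we have $$T_n(B,\epsilon)\ \le\ c\,B\,n^3\log\frac1\epsilon .$$
   Context: Let $\mathcal N=\{1,\ldots,n\}$ and let $G(t)=(\mathcal N,\mathcal E(t))$, $t=0,1,2,\ldots$, be a sequence of graphs. A graph $G(t)$ is symmetric if $(i,j)\in\mathcal E(t)$ if and only if $(j,i)\in\mathcal E(t)$. Let $\mathcal N_i(t)=\{j\ne i:(i,j)\in\mathcal E(t)\}$ be the set of neighbors of $i$ at time $t$ ($i$ itself excluded). Load-balancing averaging algorithm. Each node $i$ holds a value $x_i(t)$ at the beginning of step $t$. At each time $t$, every node $i$ does the following. If $\mathcal N_i(t)$ is empty, node $i$ does nothing. Otherwise: 1. Node $i$ broadcasts its current value $x_i$ to all of its neighbors. 2. Node $i$ finds a neighbor $j\in\mathcal N_i(t)$ with the smallest value. If $x_i\le x_j$, node $i$ does nothing further at this step. If $x_j<x_i$, node $i$ makes an offer of $(x_i-x_j)/2$ to node $j$. 3. If node $i$ does not receive any offers, it does nothing further at this step. Otherwise, it sends an acceptance to the sender of the largest offer and a rejection to all the other senders, and updates $x_i$ by adding the value of the accepted offer. 4. If an acceptance arrives for the offer made by node $i$, node $i$ updates $x_i$ by subtracting the value of that offer. The value of node $i$ after these steps is $x_i(t+1)$. Let $V(t)=\big\|x(t)-\frac1n\sum_{i=1}^n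 x_i(0)\,\mathbf 1\big\|_2^2$, where $\mathbf 1$ is the all-ones vector. For a graph sequence $G(\cdot)$ and initial vector $x(0)$, let $$T_{G(\cdot)}(x(0),\epsilon)=\min\{t\ :\ V(\tau)\le\epsilon V(0)\ \ \forall\,\tau\ge t\}.$$ Bounded interconnectivity times with parameter $B$ (a positive integer): for every integer $k\ge0$, the graph $\big(\mathcal N,\mathcal E(kB)\cup\mathcal E(kB+1)\cup\cdots\cup\mathcal E((k+1)B-1)\big)$ is strongly connected. The worst-case convergence time $T_n(B,\epsilon)$ is the maximum of $T_{G(\cdot)}(x(0),\epsilon)$ over all sequences $G(\cdot)$ of symmetric graphs on $n$ nodes that have bounded interconnectivity times with that parameter $B$, and over all initial conditions $x(0)$. $\log$ is the base-2 logarithm.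
   Formalization: The bound proved is max(B, c B n^3 log(1/ε)) instead of c B n^3 log(1/ε): as printed the claim fails for ε near 1, since T_n(B,ε) ≥ B for every n ≥ 2 and ε < 1, while the printed right-hand side tends to 0. *)

(* Defs.v *)
From mathcomp Require Import all_boot all_order all_algebra.
From mathcomp Require Import all_classical all_reals all_analysis.

Set Implicit Arguments.
Unset Strict Implicit.
Unset Printing Implicit Defensive.

Import Order.TTheory GRing.Theory Num.Theory.

Local Open Scope ring_scope.
Local Open Scope classical_set_scope.

(* A graph on n nodes is its edge relation; self-loops are allowed but
   never count as neighbors. *)
Definition neighbor (n : nat) (E : rel 'I_n) (i : 'I_n) : pred 'I_n :=
  [pred j | (j != i) && E i j].

Definition strongly_connected (n : nat) (E : rel 'I_n) : Prop :=
  forall i j : 'I_n, connect E i j.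

Definition bounded_interconnectivity (n B : nat) (G : nat -> rel 'I_n) : Prop :=
  forall k : nat,
    strongly_connected (fun i j => [exists s : 'I_B, G (k * B + s)%N i j]).

Section LoadBalancing.
Context {R : realType} {n : nat}.
Implicit Types (E : rel 'I_n) (x y : 'rV[R]_n) (s a : 'I_n -> option 'I_n).

(* [s i] is the neighbor with the smallest value that node i selects. When
   several neighbors attain the minimum, any of them may be selected. *)
Definition selects_smallest E x s : Prop :=
  forall i, match s i with
    | None => forall j, ~~ neighbor E i j
    | Some j => neighbor E i j /\ forall k, neighbor E i k -> x 0 j <= x 0 k
    end.

Definition offers x s (i j : 'I_n) : bool := (s i == Some j) && (x 0 j < x 0 i).

Definition offer_value x (i j : 'I_n) : R := (x 0 i - x 0 j) / 2.

(* [a i] is the sender of the offer that node i accepts. When several offers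
   are largest, any one of them (and only one) may be accepted. *)
Definition accepts_largest x s a : Prop :=
  forall i, match a i with
    | None => forall k, ~~ offers x s k i
    | Some k => offers x s k i /\
        forall l, offers x s l i -> offer_value x l i <= offer_value x k i
    end.

Definition gain x a (i : 'I_n) : R :=
  if a i is Some k then offer_value x k i else 0.

Definition loss x s a (i : 'I_n) : R :=
  if s i is Some j then (if a j == Some i then offer_value x i j else 0) else 0.

Definition load_balancing_step E x y : Prop :=
  exists s a, [/\ selects_smallest E x s, accepts_largest x s a &
    forall i, y 0 i = x 0 i + gain x a i - loss x s a i].

Definition load_balancing_run (G : nat -> rel 'I_n) (x : nat -> 'rV[R]_n) : Prop :=
  forall t, load_balancing_step (G t) (x t) (x t.+1).

Definition deviation (x : nat -> 'rV[R]_n) (t : nat) : R :=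
  \sum_i (x t 0 i - (\sum_j x 0%N 0 j) / n%:R) ^+ 2.

(* Extended-real valued, so that it is +oo when no such t exists. *)
Definition convergence_time (eps : R) (x : nat -> 'rV[R]_n) : \bar R :=
  ereal_inf [set (t%:R)%:E | t in
    [set t : nat | forall tau : nat, (t <= tau)%N ->
       deviation x tau <= eps * deviation x 0%N]].

End LoadBalancing.

(* The supremum also ranges over all resolutions of ties. Convergence times are
   naturals or +oo, so a finite supremum is a maximum. *)
Definition worst_convergence_time (R : realType) (n B : nat) (eps : R) : \bar R :=
  ereal_sup [set T : \bar R | exists G (x : nat -> 'rV[R]_n),
    [/\ forall t, symmetric (G t),
        bounded_interconnectivity B G,
        load_balancing_run G x &
        T = convergence_time eps x]].

(* For n >= 2 and every eps < 1, worst_convergence_time n B eps >= B, since the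
   first B - 1 graphs may be empty. As log2 (1 / eps) vanishes when eps -> 1, an
   upper bound proportional to it has to be floored at B. *)
Definition log2 (R : realType) (x : R) : R := ln x / ln 2.

(* Main.v *)
Require Import Defs.
From mathcomp Require Import all_boot all_order all_algebra.
From mathcomp Require Import all_classical all_reals all_analysis.
From mathcomp Require Import ring lra zify.

Import Order.TTheory GRing.Theory Num.Theory.

Local Open Scope ring_scope.

(** The squared deviation V drops by at least twice the sum of the squares of
    all transfers made during a step ([step_energy]).  A node v that accepts a
    transfer of size g from a sender k satisfies x_k = x_v + 2 g, so the step
    levels an interval of values [[x_v, x_v + 2 g]] whose squared length is
    4 g^2.

    These intervals reach far.  At any single time the endpoints of an edge
    have their values enclosed by the interval of some accepted transfer
    ([edge_covered]): the upper endpoint makes an offer to a neighbor that is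
    at least as low as the lower endpoint, and that neighbor accepts an offer
    at least as large.  Now sort the values at time kB and take a positive gap
    between two consecutive ones.  Connectivity of the union graph provides an
    edge across this gap during the block of B steps; before the first such
    edge the two sides do not interact, hence the gap cannot shrink, and when
    the edge appears the whole gap lies in the interval of an accepted transfer
    ([gap_covered]).  Gaps are disjoint, so those inside one interval have a
    sum of squares at most the squared length of the interval
    ([sum_sqr_gaps_cover]).  Therefore the sum D of the squared gaps at time kB
    is at most 4 sum g^2 over the block, that is, at most
    2 (V(kB) - V((k+1)B)).

    Conversely V(kB) <= n (max - min)^2 <= n^2 D by the Cauchy-Schwarz
    inequality, so each block multiplies V by at most 1 - 1/(2 n^2)
    ([deviation_contraction]).  About 2 n^2 ln(1/eps) blocks, and at least one,
    are then enough, since V is nonincreasing; this is within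
    max (B, 4 B n^3 log2(1/eps)), the exponent 3 leaving room to spare. *)

(** * Gaps of a nonincreasing sequence *)

Section Gaps.
Context {R : realDomainType}.
Implicit Types (y : nat -> R) (m : nat).

Lemma sum_gapsE y m : \sum_(d < m) (y d - y d.+1) = y 0%N - y m.
Proof.
elim: m => [|m IH]; first by rewrite big_ord0 subrr.
by rewrite big_ord_recr /= IH; ring.
Qed.

Lemma sum_sqr_le_sqr_sum (I : finType) (P : pred I) (g : I -> R) :
  (forall i, P i -> 0 <= g i) ->
  \sum_(i | P i) g i ^+ 2 <= (\sum_(i | P i) g i) ^+ 2.
Proof.
move=> g_ge0; rewrite expr2 mulr_suml ler_sum // => i Pi.
rewrite expr2 ler_wpM2l ?g_ge0 // (bigD1 i) //= lerDl.
by apply: sumr_ge0 => j /andP[Pj _]; exact: g_ge0.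
Qed.

(** The gaps inside [[lo, hi]] are disjoint, so their lengths add up to at most
    [hi - lo]; clamping the sequence to [[lo, hi]] makes this a telescoping
    sum. *)
Lemma sum_sqr_gaps_between y m (lo hi : R) :
  (forall d, (d < m)%N -> y d.+1 <= y d) -> lo <= hi ->
  \sum_(d < m | (lo <= y d.+1) && (y d <= hi)) (y d - y d.+1) ^+ 2 <=
    (hi - lo) ^+ 2.
Proof.
move=> y_dec lohi.
apply: (@le_trans _ _
  ((\sum_(d < m | (lo <= y d.+1) && (y d <= hi)) (y d - y d.+1)) ^+ 2)).
  by apply: sum_sqr_le_sqr_sum => d _; rewrite subr_ge0 y_dec.
rewrite ler_sqr ?nnegrE ?subr_ge0 //; last first.
  by apply: sumr_ge0 => d _; rewrite subr_ge0 y_dec.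
(* Clamping keeps the gaps inside [lo, hi] and can only shrink the others
   to a nonnegative length. *)
pose c v := Num.max lo (Num.min hi v).
have c_homo u v : u <= v -> c u <= c v.
  by move=> uv; rewrite /c ge_max !le_max !le_min !ge_min !lexx uv /= !orbT.
have c_id v : lo <= v -> v <= hi -> c v = v.
  by move=> lov vhi; rewrite /c min_r // max_r.
have c_ge v : lo <= c v by rewrite /c le_max lexx.
have c_le v : c v <= hi by rewrite /c ge_max lohi ge_min lexx.
apply: (@le_trans _ _ (\sum_(d < m) (c (y d) - c (y d.+1)))); last first.
  by rewrite (sum_gapsE (c \o y)) /= lerB.
rewrite big_mkcond ler_sum //= => d _.
have ydd : y d.+1 <= y d by exact: y_dec.
case: ifP => [/andP[lod dhi]|_]; last by rewrite subr_ge0 c_homo.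
by rewrite !c_id ?(le_trans lod) // (le_trans ydd).
Qed.

(** Assign each positive gap to an interval containing it and charge its square
    to that interval. *)
Lemma sum_sqr_gaps_cover (T : finType) (lo hi : T -> R) y m :
  (forall d, (d < m)%N -> y d.+1 <= y d) -> (forall e, lo e <= hi e) ->
  (forall d, (d < m)%N -> y d.+1 < y d ->
     exists e, lo e <= y d.+1 /\ y d <= hi e) ->
  \sum_(d < m) (y d - y d.+1) ^+ 2 <= \sum_e (hi e - lo e) ^+ 2.
Proof.
move=> y_dec lohi cover.
apply: (@le_trans _ _ (\sum_e \sum_(d < m | (lo e <= y d.+1) && (y d <= hi e))
    (y d - y d.+1) ^+ 2)); last first.
  by apply: ler_sum => e _; exact: sum_sqr_gaps_between.
under [leRHS]eq_bigr do rewrite big_mkcond /=.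
rewrite exchange_big /=; apply: ler_sum => d _.
have term_ge0 e : 0 <= (if (lo e <= y d.+1) && (y d <= hi e)
                         then (y d - y d.+1) ^+ 2 else 0).
  by case: ifP => // _; exact: sqr_ge0.
have := y_dec d (ltn_ord d); rewrite le_eqVlt => /orP[/eqP ->|lt_d].
  by rewrite subrr expr0n /=; apply: sumr_ge0 => e _; case: ifP.
have [e [lo_e hi_e]] := cover d (ltn_ord d) lt_d.
by rewrite (bigD1 e) //= lo_e hi_e lerDl sumr_ge0.
Qed.

(** Cauchy-Schwarz against the constant 1, from g_i g_j <= (g_i^2 + g_j^2)/2. *)
Lemma sqr_sum_le (m : nat) (g : 'I_m -> R) :
  (\sum_i g i) ^+ 2 <= m%:R * \sum_i g i ^+ 2.
Proof.
rewrite -(@ler_pMn2r _ 2) // expr2 big_distrlr /=.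
have -> : (m%:R * \sum_i g i ^+ 2) *+ 2 =
    \sum_i \sum_j (g i ^+ 2 + g j ^+ 2).
  under [RHS]eq_bigr do rewrite big_split /= sumr_const card_ord.
  by rewrite big_split /= sumr_const card_ord sumrMnl -[in RHS]mulr_natl.
rewrite -sumrMnl; apply: ler_sum => i _; rewrite -sumrMnl.
apply: ler_sum => j _; have := sqr_ge0 (g i - g j); rewrite !expr2; lra.
Qed.

End Gaps.

(** * One step of load balancing *)

Section Step.
Context {R : realType} {n : nat}.
Variables (E : rel 'I_n) (x : 'rV[R]_n) (s a : 'I_n -> option 'I_n).
Hypothesis sP : selects_smallest E x s.
Hypothesis aP : accepts_largest x s a.

Lemma accepted_offers k i : a i = Some k -> s k = Some i /\ x 0 i < x 0 k.
Proof. by move=> aik; have := aP i; rewrite aik => -[/andP[/eqP]]. Qed.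

Lemma gain_ge0 i : 0 <= gain x a i.
Proof.
rewrite /gain; case ai: (a i) => [k|//].
have [_ ltik] := accepted_offers _ _ ai.
by rewrite divr_ge0 // subr_ge0 ltW.
Qed.

Lemma loss_ge0 i : 0 <= loss x s a i.
Proof.
rewrite /loss; case: (s i) => [j|//]; case: eqP => // /accepted_offers[_ ltji].
by rewrite divr_ge0 // subr_ge0 ltW.
Qed.

(** Each accepted transfer is seen once by its sender and once by its receiver:
    a node offers to at most one neighbor and accepts at most one offer.  This
    double counting carries the conservation of the sum and the energy
    estimate. *)
Lemma sum_sent_eq_received (F : 'I_n -> 'I_n -> R) :
  \sum_i (if s i is Some j then if a j == Some i then F i j else 0 else 0) =
  \sum_j (if a j is Some k then F k j else 0).
Proof.
transitivity (\sum_i \sum_j (if a j == Some i then F i j else 0)).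
  apply: eq_bigr => i _; case si: (s i) => [j|]; last first.
    rewrite big1 // => j _; case: eqP => // /accepted_offers[].
    by rewrite si.
  rewrite (bigD1 j) //= [X in _ + X]big1 ?addr0 // => k kj.
  case: eqP => // /accepted_offers[]; rewrite si => -[jk].
  by rewrite jk eqxx in kj.
rewrite exchange_big; apply: eq_bigr => j _; case: (a j) => [k|]; last first.
  by rewrite big1.
rewrite (bigD1 k) //= eqxx big1 ?addr0 // => i ik.
by case: eqP => // -[ki]; rewrite ki eqxx in ik.
Qed.

Variable y : 'rV[R]_n.
Hypothesis yE : forall i, y 0 i = x 0 i + gain x a i - loss x s a i.

Lemma step_sum : \sum_i y 0 i = \sum_i x 0 i.
Proof.
under eq_bigr do rewrite yE.
by rewrite sumrB big_split /= -(sum_sent_eq_received (offer_value x)) addrK.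
Qed.

(** A node may give l and receive g in the same step.  The linear terms
    2 (x_i - c) (g - l), regrouped by transfer, sum to -4 sum g^2, because
    sender and receiver differ by 2 g; the quadratic terms (g - l)^2 <= g^2 + l^2
    give back at most 2 sum g^2. *)
Lemma step_energy (c : R) :
  \sum_i (y 0 i - c) ^+ 2 + 2 * \sum_i gain x a i ^+ 2 <=
  \sum_i (x 0 i - c) ^+ 2.
Proof.
have lossE (f : 'I_n -> R) (p : nat) : (0 < p)%N ->
    \sum_i f i * loss x s a i ^+ p =
    \sum_j (if a j is Some k then f k * offer_value x k j ^+ p else 0).
  move=> p0.
  rewrite -(sum_sent_eq_received (fun i j => f i * offer_value x i j ^+ p)).
  apply: eq_bigr => i _; rewrite /loss; case: (s i) => [j|]; last first.
    by rewrite expr0n gtn_eqF // mulr0.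
  by case: eqP => // _; rewrite expr0n gtn_eqF // mulr0.
have sqrE : \sum_i loss x s a i ^+ 2 = \sum_i gain x a i ^+ 2.
  transitivity (\sum_i 1 * loss x s a i ^+ 2).
    by apply: eq_bigr => i _; rewrite mul1r.
  rewrite lossE //; apply: eq_bigr => i _; rewrite /gain.
  by case: (a i) => [k|]; rewrite ?mul1r ?expr0n.
have crossE : \sum_i (x 0 i - c) * (gain x a i - loss x s a i) =
    - 2 * \sum_i gain x a i ^+ 2.
  under eq_bigr do rewrite mulrBr.
  rewrite sumrB; under [X in _ - X]eq_bigr do rewrite -[loss _ _ _ _]expr1.
  rewrite lossE // -sumrB mulr_sumr; apply: eq_bigr => i _; rewrite /gain.
  case: (a i) => [k|]; last by rewrite expr0n /= !mulr0 subrr.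
  by rewrite expr1 /offer_value; field.
have : \sum_i (y 0 i - c) ^+ 2 <= \sum_i ((x 0 i - c) ^+ 2 +
    2 * ((x 0 i - c) * (gain x a i - loss x s a i)) +
    (gain x a i ^+ 2 + loss x s a i ^+ 2)).
  apply: ler_sum => i _; rewrite yE.
  have := mulr_ge0 (gain_ge0 i) (loss_ge0 i); rewrite !expr2; lra.
rewrite !big_split /= -mulr_sumr crossE sqrE; lra.
Qed.

Hypothesis symE : symmetric E.

(** A node that gives ends no lower than midway to one of its neighbors, so a
    lower bound shared by the node and its neighbors survives the step. *)
Lemma step_ge (lo : R) i : lo <= x 0 i ->
  (forall j, neighbor E i j -> lo <= x 0 j) -> lo <= y 0 i.
Proof.
move=> loi loN; rewrite yE; have := gain_ge0 i; rewrite /loss.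
case si: (s i) => [j|]; last by lra.
have := sP i; rewrite si => -[/loN loj _].
by case: eqP => _; rewrite /offer_value; lra.
Qed.

(** The upper counterpart of [step_ge].  A node that receives does so from a
    node that selected it; symmetry makes this sender one of its own
    neighbors. *)
Lemma step_le (hi : R) i : x 0 i <= hi ->
  (forall j, neighbor E i j -> x 0 j <= hi) -> y 0 i <= hi.
Proof.
move=> hii hiN; rewrite yE; have := loss_ge0 i; rewrite /gain.
case ai: (a i) => [k|]; last by lra.
have [sk _] := accepted_offers _ _ ai.
have := sP k; rewrite sk => -[/andP[/= ik Eki] _].
have : x 0 k <= hi by apply: hiN; rewrite /neighbor /= eq_sym ik symE.
by rewrite /offer_value; lra.
Qed.

(** The witness is the node v selected by i: it is at most as high as j, and
    the offer it accepts is at least the one from i.  As twice the accepted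
    offer is the height of the sender above v, the interval of the transfer
    reaches up to [x 0 i]. *)
Lemma edge_covered i j : E i j -> x 0 j < x 0 i ->
  exists v, x 0 v <= x 0 j /\ x 0 i <= x 0 v + 2 * gain x a v.
Proof.
move=> Eij ltji.
have nij : neighbor E i j.
  by rewrite /neighbor /= Eij andbT; apply: contraTneq ltji => ->; rewrite ltxx.
have := sP i; case si: (s i) => [v|]; last by move/(_ j); rewrite nij.
move=> [_ /(_ j nij) levj]; exists v; split=> //.
have off : offers x s i v by rewrite /offers si eqxx (le_lt_trans levj).
have := aP v; rewrite /gain; case: (a v) => [k|]; last by move/(_ i); rewrite off.
by move=> [_ /(_ i off)]; rewrite /offer_value; lra.
Qed.

End Step.

(** * Runs over a block of B steps *)

Lemma connect_crosses (n : nat) (E : rel 'I_n) (S : pred 'I_n) i j :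
  connect E i j -> S i -> ~~ S j -> exists u v, [/\ E u v, S u & ~~ S v].
Proof.
move=> /connectP[p Ep ->]; elim: p i Ep => [|k p IH] i /=.
  by move=> _ ->.
move=> /andP[Eik pk] Si Sl; have [Sk|nSk] := boolP (S k); first exact: IH Sk Sl.
by exists i, k.
Qed.

Section Run.
Context {R : realType} {n : nat}.
Variables (B : nat) (G : nat -> rel 'I_n) (x : nat -> 'rV[R]_n).
Hypothesis symG : forall t, symmetric (G t).
Hypothesis conG : bounded_interconnectivity B G.
Variables (s a : nat -> 'I_n -> option 'I_n).
Hypothesis sP : forall t, selects_smallest (G t) (x t) (s t).
Hypothesis aP : forall t, accepts_largest (x t) (s t) (a t).
Hypothesis xE : forall t i,
  x t.+1 0 i = x t 0 i + gain (x t) (a t) i - loss (x t) (s t) (a t) i.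

(** Until the first edge between the nodes above the gap and those below it,
    each side averages only within itself, so that [step_ge] and [step_le] keep
    the upper side above [hi] and the lower side below [lo].  That first edge
    then joins a value at least [hi] to one at most [lo], and [edge_covered]
    applies. *)
Lemma gap_covered (k : nat) (lo hi : R) i j : lo < hi ->
  (forall v, x (k * B)%N 0 v <= lo \/ hi <= x (k * B)%N 0 v) ->
  hi <= x (k * B)%N 0 i -> x (k * B)%N 0 j <= lo ->
  exists (r : 'I_B) v, x (k * B + r)%N 0 v <= lo /\
    hi <= x (k * B + r)%N 0 v + 2 * gain (x (k * B + r)%N) (a (k * B + r)%N) v.
Proof.
move=> lohi cut hii jlo.
pose S : pred 'I_n := [pred v | hi <= x (k * B)%N 0 v].
pose crosses r := [exists u, exists v, [&& G (k * B + r)%N u v, S u & ~~ S v]].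
have [r0 cr0] : exists r : 'I_B, crosses r.
  have nSj : ~~ S j by rewrite /= -ltNge (le_lt_trans jlo).
  have [u [v [/existsP[r Guv] Su Sv]]] := connect_crosses _ _ S _ _ (conG k i j) hii nSj.
  by exists r; apply/existsP; exists u; apply/existsP; exists v; rewrite Guv Su.
have exr : exists r, crosses r by exists r0.
case: (ex_minnP exr) => r cr rmin.
have rB : (r < B)%N by rewrite (leq_ltn_trans (rmin _ cr0)).
have inv q : (q <= r)%N -> forall v,
    if S v then hi <= x (k * B + q)%N 0 v else x (k * B + q)%N 0 v <= lo.
  elim: q => [_ v|q IH qr v].
    by rewrite addn0; case: ifPn => // /negP nSv; have [|/nSv] := cut v.
  have ncr : ~~ crosses q by apply: contraL qr => /rmin; rewrite -leqNgt.
  have {}IH := IH (ltnW qr).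
  have same u : neighbor (G (k * B + q)%N) v u -> S u = S v.
    move=> /andP[/= _ Gvu].
    have Guv : G (k * B + q)%N u v by rewrite symG.
    apply: contraNeq ncr => nSuv; apply/existsP.
    case Su: (S u) nSuv; case Sv: (S v) => // _.
      by exists u; apply/existsP; exists v; rewrite Guv Su Sv.
    by exists v; apply/existsP; exists u; rewrite Gvu Su Sv.
  rewrite addnS; have := IH v; case: ifP => Sv IHv.
    apply: (step_ge _ _ _ _ (sP _) (aP _) _ (xE _)) => // u /same Su.
    by have := IH u; rewrite Su Sv.
  apply: (step_le _ _ _ _ (sP _) (aP _) _ (xE _) (symG _)) => // u /same Su.
  by have := IH u; rewrite Su Sv.
have /existsP[u /existsP[v /and3P[Guv Su Sv]]] := cr.
have := inv r (leqnn r) u; rewrite Su => hiu.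
have := inv r (leqnn r) v; rewrite (negbTE Sv) => vlo.
have [w [wv uw]] := edge_covered _ _ _ _ (sP _) (aP _) _ _ Guv
  (le_lt_trans vlo (lt_le_trans lohi hiu)).
exists (Ordinal rB), w; split; first exact: le_trans vlo.
exact: le_trans uw.
Qed.

Lemma run_sum t : \sum_i x t 0 i = \sum_i x 0%N 0 i.
Proof. by elim: t => // t <-; exact: (step_sum _ _ _ (aP t) _ (xE t)). Qed.

Lemma deviation_step t : deviation x t.+1 +
  2 * \sum_i gain (x t) (a t) i ^+ 2 <= deviation x t.
Proof. exact: (step_energy _ _ _ (aP t) _ (xE t)). Qed.

Lemma deviation_steps t m : deviation x (t + m)%N +
  2 * \sum_(r < m) \sum_i gain (x (t + r)%N) (a (t + r)%N) i ^+ 2 <= deviation x t.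
Proof.
elim: m => [|m IH]; first by rewrite big_ord0 mulr0 !addr0 addn0.
rewrite big_ord_recr /= addnS; have := deviation_step (t + m)%N; lra.
Qed.

Lemma deviation_nonincreasing t u : (t <= u)%N -> deviation x u <= deviation x t.
Proof.
move=> /subnKC <-; have := deviation_steps t (u - t).
suff : 0 <= \sum_(r < u - t) \sum_i
    gain (x (t + r)%N) (a (t + r)%N) i ^+ 2 by lra.
by apply: sumr_ge0 => r _; apply: sumr_ge0 => i _; exact: sqr_ge0.
Qed.

(** The sequence [y] lists the values at time [t] in decreasing order.  Its four
    properties are all that is needed afterwards: nodes are never renumbered,
    and every value lies on one side of each gap. *)
Lemma deviation_le_gaps (t : nat) : exists (y : nat -> R), [/\
  forall d, (d < n.-1)%N -> y d.+1 <= y d,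
  forall d, (d < n)%N -> exists i, x t 0 i = y d,
  forall d i, (d < n.-1)%N -> x t 0 i <= y d.+1 \/ y d <= x t 0 i &
  deviation x t <= n%:R ^+ 2 * \sum_(d < n.-1) (y d - y d.+1) ^+ 2].
Proof.
pose l := sort (>=%R : rel R) [seq x t 0 i | i <- enum 'I_n].
have sz : size l = n by rewrite size_sort size_map size_enum_ord.
have l_sorted : sorted (>=%R : rel R) l.
  by apply: sort_sorted => u v; rewrite /= le_total.
have l_dec (d e : nat) : (d <= e)%N -> (e < n)%N -> l`_e <= l`_d.
  move=> de en; apply: (sorted_leq_nth (leT := >=%R : rel R)) => //.
  - by move=> u v w /= vu uw; exact: le_trans uw vu.
  - by move=> u /=.
  - by rewrite inE sz (leq_ltn_trans de).
  - by rewrite inE sz.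
have l_surj i : exists2 d, (d < n)%N & l`_d = x t 0 i.
  have /(nthP 0)[d] : x t 0 i \in l by rewrite mem_sort map_f ?mem_enum.
  by rewrite sz => dn ld; exists d.
exists (nth 0 l); split.
- by move=> d dn; apply: l_dec => //; lia.
- move=> d dn; have : l`_d \in l by rewrite mem_nth ?sz.
  by rewrite mem_sort => /mapP[i _ ->]; exists i.
- move=> d i dn; have [e en <-] := l_surj i.
  have [ed|de] := leqP e d; [right|left]; apply: l_dec => //; lia.
have [n0|n_gt0] := posnP n.
  rewrite /deviation big1 => [|i _]; last by have := ltn_ord i; rewrite [X in (_ < X)%N]n0.
  by rewrite mulr_ge0 ?sqr_ge0 // sumr_ge0 // => d _; exact: sqr_ge0.
pose lo := l`_n.-1; pose hi := l`_0%N.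
have x_lo i : lo <= x t 0 i by have [d dn <-] := l_surj i; apply: l_dec; lia.
have x_hi i : x t 0 i <= hi by have [d dn <-] := l_surj i; apply: l_dec; lia.
have nR : (0 : R) < n%:R by rewrite ltr0n.
(* The deviation refers to the mean at time 0, which is also the mean at
   time t and thus lies between the extreme values at time t. *)
have mean_lo : lo <= (\sum_j x 0%N 0 j) / n%:R.
  rewrite ler_pdivlMr // -(run_sum t).
  rewrite mulr_natr -[n in lo *+ n]card_ord -sumr_const; exact: ler_sum.
have mean_hi : (\sum_j x 0%N 0 j) / n%:R <= hi.
  rewrite ler_pdivrMr // -(run_sum t).
  rewrite mulr_natr -[n in hi *+ n]card_ord -sumr_const; exact: ler_sum.
have dev_range : deviation x t <= n%:R * (hi - lo) ^+ 2.
  rewrite mulr_natl -[n in _ *+ n]card_ord -sumr_const; apply: ler_sum => i _.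
  rewrite -real_normK ?num_real // ler_sqr ?nnegrE ?normr_ge0 //.
    by have := x_lo i; have := x_hi i; rewrite ler_norml; lra.
  by rewrite subr_ge0 (le_trans mean_lo).
apply: (le_trans dev_range); rewrite expr2 -mulrA ler_pM2l //.
rewrite -(sum_gapsE (nth 0 l)); apply: le_trans (sqr_sum_le _ _) _.
rewrite ler_wpM2r ?ler_nat ?leq_pred // sumr_ge0 // => d _; exact: sqr_ge0.
Qed.

Lemma deviation_contraction k : (0 < n)%N ->
  deviation x (k.+1 * B)%N <= (1 - (2 * n%:R ^+ 2)^-1) * deviation x (k * B)%N.
Proof.
move=> n_gt0; have [y [y_dec y_val y_cut dev_le]] := deviation_le_gaps (k * B)%N.
have := deviation_steps (k * B)%N B; rewrite -mulSnr.
(* A pair e = (r, v) stands for the transfer accepted by v at time kB + r; its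
   interval [lo e, lo e + 2 gn e] is a point when v accepts nothing. *)
pose lo (e : 'I_B * 'I_n) := x (k * B + e.1)%N 0 e.2.
pose gn (e : 'I_B * 'I_n) := gain (x (k * B + e.1)%N) (a (k * B + e.1)%N) e.2.
have gaps_le : \sum_(d < n.-1) (y d - y d.+1) ^+ 2 <=
    \sum_e ((lo e + 2 * gn e) - lo e) ^+ 2.
  apply: (sum_sqr_gaps_cover _ lo (fun e => lo e + 2 * gn e)) => //.
    by move=> e; rewrite lerDl mulr_ge0 // (gain_ge0 _ _ _ (aP _)).
  move=> d dn lt_d.
  have [i iE] := y_val d ltac:(lia); have [j jE] := y_val d.+1 ltac:(lia).
  have [||r [v cov]] := gap_covered k (y d.+1) (y d) i j lt_d (y_cut d ^~ dn).
  - by rewrite iE.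
  - by rewrite jE.
  by exists (r, v).
have -> : \sum_(r < B) \sum_i
    gain (x (k * B + r)%N) (a (k * B + r)%N) i ^+ 2 = \sum_e gn e ^+ 2.
  by rewrite pair_big.
move: gaps_le; have -> : \sum_e ((lo e + 2 * gn e) - lo e) ^+ 2 =
    4 * \sum_e gn e ^+ 2.
  by rewrite mulr_sumr; apply: eq_bigr => e _; ring.
set g := \sum_(d < _) _ in dev_le *; set h := \sum_e _ => gaps_le.
have n2 : (0 : R) < n%:R ^+ 2 by rewrite exprn_gt0 // ltr0n.
have dev_h : (2 * n%:R ^+ 2)^-1 * deviation x (k * B)%N <= 2 * h.
  rewrite mulrC ler_pdivrMr; last by lra.
  apply: le_trans dev_le _.
  by have := ler_wpM2l (ltW n2) gaps_le; lra.
by move=> dev_dec; rewrite mulrBl mul1r; lra.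
Qed.

Lemma deviation_geometric k : (0 < n)%N ->
  deviation x (k * B)%N <= (1 - (2 * n%:R ^+ 2)^-1) ^+ k * deviation x 0%N.
Proof.
move=> n_gt0; elim: k => [|k IH]; first by rewrite mul0n expr0 mul1r.
apply: le_trans (deviation_contraction k n_gt0) _.
have n2 : (1 : R) <= n%:R ^+ 2 by rewrite exprn_ege1 // ler1n.
rewrite (exprS _ k) -mulrA; apply: ler_wpM2l IH.
by rewrite subr_ge0 invf_le1; lra.
Qed.

End Run.

(** * The convergence time *)

(** From 1 - u <= exp (- u) with u = 1 / (2 n^2). *)
Lemma geometric_le_eps (R : realType) (n k : nat) (eps : R) :
  (0 < n)%N -> 0 < eps ->
  2 * n%:R ^+ 2 * - ln eps <= k%:R -> (1 - (2 * n%:R ^+ 2)^-1) ^+ k <= eps.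
Proof.
move=> n_gt0 eps_gt0 kn.
have n2 : (1 : R) <= n%:R ^+ 2 by rewrite exprn_ege1 // ler1n.
have n2' : (0 : R) < 2 * n%:R ^+ 2 by lra.
apply: (@le_trans _ _ (expR (- (2 * n%:R ^+ 2)^-1) ^+ k)).
  apply: lerXn2r; rewrite ?nnegrE ?expR_ge0 //; last exact: expR_ge1Dx.
  by rewrite subr_ge0 invf_le1 //; lra.
rewrite -expRM_natl -[leRHS](@lnK R) ?posrE // ler_expR.
by rewrite mulrN lerNl ler_pdivlMr // mulrC.
Qed.

Theorem theorem8p4 (R : realType) :
  exists c : R, 0 < c /\
    forall (n B : nat) (eps : R),
      (0 < n)%N -> (0 < B)%N -> 0 < eps < 1 ->
      (worst_convergence_time n B eps <=
         (Num.max B%:R (c * B%:R * n%:R ^+ 3 * log2 (1 / eps)))%:E)%E.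
Proof.
exists 4; split=> // n B eps n_gt0 B_gt0 /andP[eps_gt0 eps_lt1].
apply: ge_ereal_sup => _ [G [x [symG conG runG ->]]].
have [s sP] := choice runG; have [a saP] := choice sP.
pose L : R := 4 * n%:R ^+ 3 * log2 (1 / eps).
have ln_eps : ln eps < 0 by rewrite ln_lt0 // eps_gt0.
have ln2_gt0 : 0 < ln (2 : R) by rewrite ln_gt0 // ltr1n.
have ln2_le1 : ln (2 : R) <= 1.
  by have := @le_ln1Dx R 1; rewrite -natr1; apply; lra.
have log_ge : - ln eps <= log2 (1 / eps).
  rewrite /log2 div1r lnV ?posrE // ler_pdivlMr //; nra.
have n1 : (1 : R) <= n%:R by rewrite ler1n.
have n3 : (n%:R : R) ^+ 2 <= n%:R ^+ 3 by rewrite ler_weXn2l.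
have n2 : (0 : R) <= n%:R ^+ 2 by rewrite sqr_ge0.
have L_ge : 4 * n%:R ^+ 2 * - ln eps <= L by rewrite /L; nra.
have L_ge0 : 0 <= L by apply: le_trans L_ge; nra.
(* At least one block is needed even when L < 1, which costs B steps.  Rounding
   down loses at most half since k >= 1: L < 2 k, and c = 4 makes L at least
   4 n^2 ln(1/eps), because ln 2 <= 1. *)
pose k := maxn 1 (Num.truncn L).
have k_ge : 2 * n%:R ^+ 2 * - ln eps <= k%:R.
  have /andP[_ L_lt] := truncn_itv L_ge0.
  have : ((Num.truncn L).+1%:R : R) <= k%:R + k%:R by rewrite -natrD ler_nat /k; lia.
  by nra.
have k_le : (k * B)%:R <= Num.max (B%:R : R) (B%:R * L).
  have /andP[L_ge_trunc _] := truncn_itv L_ge0.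
  rewrite /k /maxn; case: ifP => _.
    by rewrite le_max natrM (mulrC B%:R L) ler_wpM2r ?orbT.
  by rewrite mul1n le_max lexx.
apply: (@le_trans _ _ ((k * B)%:R)%:E); last first.
  rewrite lee_fin.
  suff -> : 4 * B%:R * n%:R ^+ 3 * log2 (1 / eps) = B%:R * L by [].
  by rewrite /L; ring.
apply: ereal_inf_lbound; exists (k * B)%N => //= tau ktau.
have sP' t : selects_smallest (G t) (x t) (s t) by have [] := saP t.
have aP' t : accepts_largest (x t) (s t) (a t) by have [] := saP t.
have xE' t : forall i, x t.+1 0 i = x t 0 i + gain (x t) (a t) i -
  loss (x t) (s t) (a t) i by have [] := saP t.
apply: (le_trans (deviation_nonincreasing _ _ _ aP' xE' _ _ ktau)).
apply: (le_trans (deviation_geometric _ _ _ symG conG _ _ sP' aP' xE' k n_gt0)).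
rewrite ler_wpM2r ?geometric_le_eps //.
by apply: sumr_ge0 => i _; exact: sqr_ge0.
Qed.
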